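(* Let $m,n,t$ be positive integers with $m<\dfrac t2$ and $n>t-m+1$. Then $dyn_t(K_m\Box K_n)=m(t-m+1)$.
   Context: $K_n$ is the complete graph on $n$ vertices; $G\Box H$ is the Cartesian product (vertex set $V(G)\times V(H)$, $(u,v)\sim(u',v')$ iff $u=u'$ and $vv'\in E(H)$, or $v=v'$ and $uu'\in E(G)$). For constant threshold $t$, a set $D$ of vertices is a $t$-dynamic monopoly if starting from $D$ and repeatedly adding any vertex having at least $t$ neighbors in the current set eventually yields all vertices; $dyn_t$ is the minimum size of a $t$-dynamic monopoly. *)

(* Defs.v *)
From mathcomp Require Import all_boot.

Set Implicit Arguments.
Unset Strict Implicit.
Unset Printing Implicit Defensive.

Record sgraph := SGraph {
  vertex :> finType;
  adj : rel vertex;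
  adj_sym : symmetric adj;
  adj_irrefl : irreflexive adj }.

Section CompleteGraph.
Variable n : nat.

Definition complete_adj : rel 'I_n := [rel u v | u != v].

Lemma complete_sym : symmetric complete_adj.
Proof. by move=> u v; rewrite /complete_adj /= eq_sym. Qed.

Lemma complete_irrefl : irreflexive complete_adj.
Proof. by move=> u; rewrite /complete_adj /= eqxx. Qed.

Definition complete_graph : sgraph := SGraph complete_sym complete_irrefl.
End CompleteGraph.

Section CartesianProduct.
Variables G H : sgraph.

Definition cart_adj : rel (G * H)%type :=
  [rel p q | ((p.1 == q.1) && adj p.2 q.2) || ((p.2 == q.2) && adj p.1 q.1)].

Lemma cart_sym : symmetric cart_adj.
Proof.
move=> p q; rewrite /cart_adj /= (eq_sym p.1) (eq_sym p.2).
by rewrite (adj_sym p.1) (adj_sym p.2).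
Qed.

Lemma cart_irrefl : irreflexive cart_adj.
Proof. by move=> p; rewrite /cart_adj /= !adj_irrefl !andbF. Qed.

Definition cart_prod : sgraph := SGraph cart_sym cart_irrefl.
End CartesianProduct.

Section DynamicMonopoly.
Variables (G : sgraph) (t : nat).

Definition activation : rel {set G} :=
  [rel A B : {set G} |
    [exists v, (t <= #|[set u in A | adj v u]|) && (B == v |: A)]].

(* connect is the reflexive transitive closure: vertices are added one at a
   time, any finite number of times. *)
Definition dyn_monopoly (D : {set G}) : bool := connect activation D [set: G].

Lemma dyn_monopolyT : dyn_monopoly [set: G].
Proof. exact: connect0. Qed.

(* The seed [set: G] of arg min is a monopoly by dyn_monopolyT, so this is a
   genuine minimum over all monopolies; see dyn_attained and dyn_min. *)
Definition dyn : nat := #|[arg min_(D < [set: G] | dyn_monopoly D) #|D|]|.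

Lemma dyn_attained : exists2 D, dyn_monopoly D & #|D| = dyn.
Proof.
rewrite /dyn; case: arg_minnP => [|D monD _]; first exact: dyn_monopolyT.
by exists D.
Qed.

Lemma dyn_min D : dyn_monopoly D -> dyn <= #|D|.
Proof.
rewrite /dyn; case: arg_minnP => [|E _ minE]; first exact: dyn_monopolyT.
exact: minE.
Qed.
End DynamicMonopoly.

(* Main.v *)
Require Import Defs.
From mathcomp Require Import all_boot zify.

(** Write [s = t - m + 1].

    Lower bound: a vertex has only [m - 1] neighbours outside its copy of
    [K_n], so a copy of [K_n] with fewer than [s] seeds (hence not full, as
    [s < n]) never gains a vertex. Each of the [m] copies thus has [s] seeds.

    Upper bound: let the seeds of copy [i] be the columns [i, ..., i + s - 1]
    modulo [n]. The vertices [(i, i + x)], [s <= x < n], get activated in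
    lexicographic order of [(i, x)]: such a vertex sees the [x] vertices
    [(i, i + y)], [y < x], and, in its column, all of its [m - 1] neighbours
    except possibly those in copies [i + 1, ..., i + x - s]; in total at least
    [x + (m - 1) - (x - s) = t]. *)

Section ActivationClosed.
Variables (G : sgraph) (t : nat).

Definition activation_closed (A : {set G}) : Prop :=
  forall v, t <= #|[set u in A | adj v u]| -> v \in A.

(** Neighbour counts grow with the set, so an activation path that starts inside a closed set never
    leaves it. A proper closed superset of [D] therefore refutes that [D] is a monopoly. *)
Lemma dyn_monopoly_closedT (D A : {set G}) :
  dyn_monopoly t D -> D \subset A -> activation_closed A -> A = [set: G].
Proof.
move=> /connectP[p pD Dp] DA clA; apply/eqP; rewrite -subTset Dp.
elim: p D DA pD {Dp} => //= B p IHp D DA /andP[/existsP[v /andP[tv /eqP ->]]].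
apply: IHp; rewrite subUset DA andbT sub1set; apply: clA.
apply: leq_trans tv _; apply/subset_leq_card/subsetP => u.
by rewrite !inE => /andP[/(subsetP DA) -> ->].
Qed.

(** A largest set reachable from [D] is closed, since activating one more vertex would enlarge
    it. *)
Lemma dyn_monopoly_intro (D : {set G}) :
  (forall A : {set G}, D \subset A -> activation_closed A -> A = [set: G]) ->
  dyn_monopoly t D.
Proof.
move=> closedT.
pose P (A : {set G}) := connect (@activation G t) D A && (D \subset A).
have PD : P D by rewrite /P connect0 subxx.
case: (@arg_maxnP _ D P (fun A : {set G} => #|A|) PD) => A /andP[DcA DA] maxA.
suff AT : A = [set: G] by rewrite /dyn_monopoly -AT.
apply: closedT (DA) _ => v tv; apply/negPn/negP => vA.
suff /maxA : P (v |: A) by rewrite cardsU1 vA; lia.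
apply/andP; split; last exact: subset_trans DA (subsetUr _ _).
apply: connect_trans DcA _; apply: connect1.
by apply/existsP; exists v; rewrite tv eqxx.
Qed.

End ActivationClosed.

(** The neighbours of [v] lie in the two fibres through [v], which meet only in [v] itself. *)
Lemma card_cart_neighbors (G H : sgraph) (A : {set cart_prod G H})
    (v : cart_prod G H) :
  #|[set u in A | adj v u]|
  = #|[set y | adj v.2 y & (v.1, y) \in A]|
    + #|[set x | adj v.1 x & (x, v.2) \in A]|.
Proof.
case: v => i j /=.
set P := [set y | _ & _]; set Q := [set x | _ & _].
have injP : injective (pair i : H -> cart_prod G H) by move=> ? ? [].
have injQ : injective ((fun x => (x, j)) : G -> cart_prod G H) by move=> ? ? [].
rewrite -(card_imset _ injP) -(card_imset _ injQ).
rewrite -cardsUI [X in _ = _ + X]eq_card0 ?addn0.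
  apply/eq_card => -[x y]; rewrite !inE /=; apply/andP/orP.
    move=> [xyA /orP[] /andP[/eqP/= e a]].
      by left; apply/imsetP; exists y; rewrite ?inE /= e // a.
    by right; apply/imsetP; exists x; rewrite ?inE /= e // a.
  move=> [] /imsetP[z]; rewrite inE => /andP[az zA] [-> ->].
    by split=> //; rewrite /= /cart_adj /= eqxx az.
  by split=> //; rewrite /= /cart_adj /= eqxx az orbT.
move=> [x y]; rewrite !inE; apply/negbTE/negP => /andP[].
move=> /imsetP[z]; rewrite inE => /andP[az _] [_ ->].
by move=> /imsetP[w _ [_ zj]]; rewrite zj adj_irrefl in az.
Qed.

Lemma card_ord_interval (m a k : nat) :
  #|[set i : 'I_m | a <= i < a + k]| <= k.
Proof.
rewrite cardE -(size_map val) -[leqRHS](size_iota a).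
apply: uniq_leq_size; first by rewrite map_inj_uniq ?enum_uniq //; exact: val_inj.
by move=> x /mapP[i]; rewrite mem_enum inE mem_iota => ? ->.
Qed.

Section CompleteProduct.
Variables m n t : nat.
Let G := cart_prod (complete_graph m) (complete_graph n).

Lemma dyn_monopoly_row (D : {set G}) (i : 'I_m) :
  m <= t -> t - m + 1 < n -> dyn_monopoly t D ->
  t - m + 1 <= #|[set j : 'I_n | (i, j) \in D]|.
Proof.
move=> lemt ltsn monD; rewrite leqNgt; apply/negP => ltrow.
(* Even with all other copies full, a non-seed of copy [i] sees at most [(t - m) + (m - 1) < t]
   vertices of [A], so [A] is closed. *)
pose A : {set G} := D :|: [set p | p.1 != i].
have AT : A = [set: G].
  apply: (dyn_monopoly_closedT _ _ _ _ monD (subsetUl _ _)) => -[i' j].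
  rewrite card_cart_neighbors /= => tv; rewrite !inE /=.
  have [ii'|_] := eqVneq i' i; last by rewrite orbT.
  subst i'; rewrite /= orbF; apply/negPn/negP => ijD.
  have le_row : #|[set y | complete_adj j y & (i, y) \in A]|
      <= #|[set j : 'I_n | (i, j) \in D]|.
    apply/subset_leq_card/subsetP => y; rewrite !inE /= eqxx orbF.
    by case/andP.
  have le_col : #|[set x | complete_adj i x & (x, j) \in A]| <= m.-1.
    have := cardsC1 i; rewrite card_ord => <-.
    by apply/subset_leq_card/subsetP => x; rewrite !inE /= eq_sym => /andP[].
  have := leq_trans tv (leq_add le_row le_col).
  by have := ltn_ord i; lia.
suff rowT : [set j : 'I_n | (i, j) \in D] = [set: 'I_n].
  by rewrite rowT cardsT card_ord in ltrow; lia.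
apply/setP => j; rewrite !inE.
by have := in_setT ((i, j) : G); rewrite -AT !inE /= eqxx orbF.
Qed.

Lemma dyn_monopoly_card (D : {set G}) :
  m <= t -> t - m + 1 < n -> dyn_monopoly t D -> m * (t - m + 1) <= #|D|.
Proof.
move=> lemt ltsn monD; rewrite -{1}[m]card_ord -sum_nat_const.
suff -> : #|D| = \sum_(i < m) #|[set j : 'I_n | (i, j) \in D]|.
  by apply: leq_sum => i _; apply: dyn_monopoly_row.
rewrite -sum1_card.
under [RHS]eq_bigr do rewrite -sum1_card.
by rewrite pair_big_dep; apply: eq_big => [[i j]|//]; rewrite /= inE.
Qed.

End CompleteProduct.

Section CyclicSeeds.
Variables m n' t : nat.
Let n := n'.+1.
Let s := t - m + 1.
Let G := cart_prod (complete_graph m) (complete_graph n).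

(** Here [x] is the offset from the diagonal. The residue is below [n], so [inord] never takes its
    default value. *)
Definition cyclic_vertex (i : 'I_m) (x : nat) : G := (i, inord ((i + x) %% n)).

Definition cyclic_seeds : {set G} :=
  [set cyclic_vertex p.1 p.2 | p : 'I_m * 'I_s].

Lemma card_cyclic_seeds : #|cyclic_seeds| <= m * s.
Proof.
by apply: leq_trans (leq_imset_card _ _) _; rewrite card_prod !card_ord.
Qed.

Lemma cyclic_vertex_surj (i : 'I_m) (j : 'I_n) :
  m <= n -> exists2 x, x < n & cyclic_vertex i x = (i, j).
Proof.
(* The witness is [j - i] modulo [n]; the subtraction [n - i] is exact because [i < m <= n]. *)
move=> lemn; exists ((n - i + j) %% n); first by rewrite ltn_mod.
congr pair; apply/val_inj; rewrite /= modnDmr addnA subnKC; last first.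
  by have := ltn_ord i; lia.
by rewrite modnDl modn_small // inordK.
Qed.

Lemma cyclic_vertex_inj (i : 'I_m) (x y : nat) :
  x < n -> y < n -> cyclic_vertex i x = cyclic_vertex i y -> x = y.
Proof.
move=> ltx lty [] /(congr1 (@nat_of_ord n)); rewrite !inordK ?ltn_mod // => /eqP.
by rewrite eqn_modDl !modn_small // => /eqP.
Qed.

Lemma cyclic_seeds_monopoly :
  2 * m < t -> s < n -> dyn_monopoly t cyclic_seeds.
Proof.
move=> ltmt ltsn; apply: dyn_monopoly_intro => A DA clA.
(* The number [k] stands for [i] so that strong induction on naturals applies, first to the copy and
   then to the offset. *)
suff inA k (i : 'I_m) x : i = k :> nat -> x < n -> cyclic_vertex i x \in A.
  apply/setP => -[i j]; rewrite inE.
  have [|x ltxn <-] := cyclic_vertex_surj i j; first by rewrite /s in ltsn; lia.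
  exact: inA (erefl _) ltxn.
elim/ltn_ind: k i x => k IHk i x ik; elim/ltn_ind: x => x IHx ltxn.
have seedA (i' : 'I_m) y : y < s -> cyclic_vertex i' y \in A.
  move=> lty; apply: (subsetP DA); apply/imsetP.
  by exists (i', Ordinal lty).
have [/seedA//|lesx] := ltnP x s.
apply: clA; rewrite card_cart_neighbors /=.
set j : 'I_n := inord _.
have row : x <= #|[set y | complete_adj j y & (i, y) \in A]|.
  pose g (y : 'I_x) : 'I_n := (cyclic_vertex i y).2.
  have injg : injective g.
    move=> y z gyz; apply/val_inj/(cyclic_vertex_inj i).
    - exact: ltn_trans (ltn_ord y) ltxn.
    - exact: ltn_trans (ltn_ord z) ltxn.
    - by congr pair.
  rewrite -[x in leqLHS]card_ord -(card_imset _ injg).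
  apply/subset_leq_card/subsetP => _ /imsetP[y _ ->].
  have ltyn := ltn_trans (ltn_ord y) ltxn.
  rewrite inE; apply/andP; split; last exact: IHx (ltn_ord y) ltyn.
  apply/eqP => jg; have := ltn_ord y.
  by rewrite -(cyclic_vertex_inj i x y) ?ltnn //; congr pair.
(* The excluded interval of copies starts at [i] itself, which is not its own neighbour, hence the
   successor. *)
have col : m - (x - s).+1 <= #|[set i' | complete_adj i i' & (i', j) \in A]|.
  have := cardsC [set i' : 'I_m | i <= i' < i + (x - s).+1].
  rewrite card_ord; have := card_ord_interval m i (x - s).+1.
  suff /subset_leq_card : ~: [set i' : 'I_m | i <= i' < i + (x - s).+1]
     \subset [set i' | complete_adj i i' & (i', j) \in A] by lia.
  apply/subsetP => i'; rewrite !inE negb_and -ltnNge -leqNgt => ii'.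
  apply/andP; split; first by apply: contraL ii' => /eqP <-; lia.
  case/orP: ii' => ii'.
    have [|y ltyn <-] := cyclic_vertex_surj i' j; first by rewrite /s in ltsn; lia.
    by apply: (IHk i') => //; rewrite -ik.
  (* Beyond the interval the offset drops below [s], giving a seed. It is not truncated: [2 * m < t]
     yields [i' - i < m < s <= x]. *)
  suff -> : (i', j) = cyclic_vertex i' (x - (i' - i)).
    by apply: seedA; rewrite /s in lesx *; lia.
  congr (_, inord (_ %% _)).
  by have := ltn_ord i'; rewrite /s in lesx; lia.
(* If the bound [col] truncates to 0, then [x >= s + m - 1 = t] and the row alone suffices. *)
apply: leq_trans (leq_add row col).
by have := ltn_ord i; rewrite /s in lesx *; lia.
Qed.

End CyclicSeeds.

Theorem theorem16 (m n t : nat) (m_gt0 : 0 < m) (n_gt0 : 0 < n) (t_gt0 : 0 < t)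
    (ltmt : 2 * m < t) (ltn : t - m + 1 < n) :
  dyn (cart_prod (complete_graph m) (complete_graph n)) t = m * (t - m + 1).
Proof.
apply/eqP; rewrite eqn_leq; apply/andP; split.
  case: n n_gt0 ltn => // n' _ ltsn.
  apply: leq_trans (card_cyclic_seeds m n' t).
  exact/dyn_min/cyclic_seeds_monopoly.
have [D monD <-] := dyn_attained (cart_prod (complete_graph m) (complete_graph n)) t.
by apply: dyn_monopoly_card => //; lia.
Qed.
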